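(* Let $x,y$ be real numbers with $x+y\neq 0$ and $\frac{x}{x+y}\geq 0$, let $z\in(-\infty,1)$ be real, and let $n\in\mathbb{N}=\{1,2,3,\ldots\}$. Then $$\sum_{k=0}^n x^k y^{n-k}\binom{n}{k}\left(\sum_{j=1}^k \frac{z^j}{j}\right)=\sum_{j=1}^n \frac{(y+zx)^j-y^j}{j}\,(x+y)^{n-j}.$$
   Context: Conventions: $0^0=1$ in the powers $x^k y^{n-k}$, and empty sums (such as $\sum_{j=1}^0$) equal $0$. *)

(* Defs.v *)
From mathcomp Require Import all_boot all_order all_algebra.
From mathcomp Require Import reals.

(* Main.v *)
Require Import Defs.
From mathcomp Require Import all_boot all_order all_algebra.
From mathcomp Require Import reals.
From mathcomp Require Import ring.
Import Order.TTheory GRing.Theory Num.Theory.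
Local Open Scope ring_scope.

(** Both sides satisfy the same first-order recurrence in [n] and vanish at
    [n = 0].  For the right-hand side, passing from [n] to [n.+1] multiplies
    every old term by [x + y] and adds the term [j = n.+1].  For the left-hand
    side, write [B n a] for the homogeneous binomial transform of a sequence
    [a]; Pascal's rule gives [B n.+1 a = y * B n a + x * B n (a \o succn)]
    ([binomial_transformS]).  If [a] is the sequence of partial sums of
    [z ^+ j / j], then [a k.+1] is [a k] plus [z ^+ k.+1 / k.+1], so the
    recurrence becomes [(x + y) * B n a] plus [x] times the transform of these
    increments, which the binomial theorem evaluates, after the absorption identity
    [n.+1 * 'C(n, k) = k.+1 * 'C(n.+1, k.+1)], to exactly the new term on the
    right ([binomial_transform_logterm]). *)

Definition binomial_transform (R : comNzRingType) (x y : R) (n : nat)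
    (a : nat -> R) : R :=
  \sum_(0 <= k < n.+1) x ^+ k * y ^+ (n - k) * 'C(n, k)%:R * a k.

(** Pascal's rule, summed against [a]: the summands with ['C(n, k)] carry an
    extra factor [y], those with ['C(n, k.-1)] an extra factor [x] and a shift
    of the sequence. *)
Lemma binomial_transformS (R : comNzRingType) (x y : R) (n : nat)
    (a : nat -> R) :
  binomial_transform R x y n.+1 a =
  y * binomial_transform R x y n a
  + x * binomial_transform R x y n (fun k => a k.+1).
Proof.
rewrite /binomial_transform big_nat_recl // [in RHS]big_distrr /=.
have -> : \sum_(0 <= k < n.+1)
      x ^+ k.+1 * y ^+ (n.+1 - k.+1) * 'C(n.+1, k.+1)%:R * a k.+1
    = \sum_(0 <= k < n.+1) x ^+ k.+1 * y ^+ (n - k) * 'C(n, k.+1)%:R * a k.+1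
    + x * \sum_(0 <= k < n.+1) x ^+ k * y ^+ (n - k) * 'C(n, k)%:R * a k.+1.
  rewrite big_distrr -big_split /=; apply: eq_bigr => k _.
  by rewrite subSS binS natrD exprS; ring.
rewrite addrA; congr (_ + _).
(* The top summand has coefficient 'C(n, n.+1) = 0; below it n - k is positive
   and releases the factor y. *)
rewrite [X in _ + X = _]big_nat_recr //= (bin_small (ltnSn n)) mulr0 mul0r addr0.
rewrite [RHS]big_nat_recl //= !bin0 !subn0 exprS; congr (_ + _).
  by rewrite !expr0 !mulr1 !mul1r mulrA.
apply: eq_big_nat => k /andP[_ ltkn].
by rewrite -(subnSK ltkn) [y ^+ (n - k.+1).+1]exprS; ring.
Qed.

(** Absorption turns ['C(n, k) / k.+1] into ['C(n.+1, k.+1) / n.+1]; what is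
    left is the binomial expansion of [(y + z * x) ^+ n.+1] without its
    constant term. *)
Lemma binomial_transform_logterm (R : numFieldType) (x y z : R) (n : nat) :
  x * binomial_transform R x y n (fun k => z ^+ k.+1 / k.+1%:R) =
  ((y + z * x) ^+ n.+1 - y ^+ n.+1) / n.+1%:R.
Proof.
rewrite exprDn -(big_mkord xpredT
  (fun i => (y ^+ (n.+1 - i) * (z * x) ^+ i) *+ 'C(n.+1, i))).
rewrite big_nat_recl //= subn0 expr0 mulr1 bin0 mulr1n addrC addKr.
rewrite /binomial_transform big_distrr big_distrl /=.
apply: eq_bigr => k _; rewrite subSS exprMn -[in RHS]mulr_natr.
have absorb : n.+1%:R * 'C(n, k)%:R = k.+1%:R * 'C(n.+1, k.+1)%:R :> R.
  by rewrite -!natrM mul_bin_diag.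
have n0 : n.+1%:R != 0 :> R by rewrite pnatr_eq0.
have k0 : k.+1%:R != 0 :> R by rewrite pnatr_eq0.
have -> : 'C(n.+1, k.+1)%:R = n.+1%:R * 'C(n, k)%:R / k.+1%:R :> R.
  by rewrite absorb mulrAC mulfV ?mul1r.
rewrite [x ^+ k.+1]exprS; move: n0 k0; move: n.+1%:R k.+1%:R => m l m0 l0.
by field; rewrite m0 l0.
Qed.

Lemma binomial_transform_logsum (R : numFieldType) (x y z : R) (n : nat) :
  binomial_transform R x y n (fun k => \sum_(1 <= j < k.+1) z ^+ j / j%:R) =
  \sum_(1 <= j < n.+1)
    ((y + z * x) ^+ j - y ^+ j) / j%:R * (x + y) ^+ (n - j).
Proof.
elim: n => [|n IHn].
  by rewrite /binomial_transform big_nat1 !big_geq // mulr0.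
rewrite binomial_transformS [RHS]big_nat_recr //= subnn expr0 mulr1.
rewrite -binomial_transform_logterm.
have -> : \sum_(1 <= j < n.+1)
      ((y + z * x) ^+ j - y ^+ j) / j%:R * (x + y) ^+ (n.+1 - j)
    = (x + y) * binomial_transform R x y n
        (fun k => \sum_(1 <= j < k.+1) z ^+ j / j%:R).
  rewrite IHn big_distrr /=; apply: eq_big_nat => j /andP[_ ltjn].
  by rewrite subSn // exprS mulrCA.
have -> : binomial_transform R x y n
      (fun k => \sum_(1 <= j < k.+2) z ^+ j / j%:R)
    = binomial_transform R x y n (fun k => \sum_(1 <= j < k.+1) z ^+ j / j%:R)
    + binomial_transform R x y n (fun k => z ^+ k.+1 / k.+1%:R).
  rewrite /binomial_transform -big_split /=; apply: eq_bigr => k _.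
  by rewrite big_nat_recr //= mulrDr.
by ring.
Qed.

Theorem theorem1p3 (R : realType) (x y z : R) (n : nat)
    (hxy : x + y != 0) (hx : 0 <= x / (x + y)) (hz : z < 1) (hn : (0 < n)%N) :
  \sum_(0 <= k < n.+1)
      x ^+ k * y ^+ (n - k) * 'C(n, k)%:R * (\sum_(1 <= j < k.+1) z ^+ j / j%:R)
  = \sum_(1 <= j < n.+1)
      ((y + z * x) ^+ j - y ^+ j) / j%:R * (x + y) ^+ (n - j).
Proof. exact: (binomial_transform_logsum R x y z n). Qed.
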